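(* The following are true. (1) For all positive integers $n$ we have $$(n^2-3n+2)M_1(n)-8M_2(n)\geq 0,$$ and for $n\geq 2$ this expression vanishes if and only if $n$ is prime. (2) For all positive integers $n$ we have $$(3n^3-13n^2+18n-8)M_1(n)+(12n^2-120n+212)M_2(n)-960M_3(n)\geq 0,$$ and for $n\geq 2$ this expression vanishes if and only if $n$ is prime.
   Context: For an integer $a\geq 1$ and a positive integer $n$, MacMahon's partition function $M_a(n)$ is $$M_a(n):=\sum_{\substack{0<s_1<s_2<\cdots<s_a\\ n=m_1s_1+m_2s_2+\cdots+m_as_a}} m_1m_2\cdots m_a,$$ where the sum runs over all tuples of positive integers $s_1<s_2<\cdots<s_a$ and $m_1,\dots,m_a$ with $n=m_1s_1+\cdots+m_as_a$. Equivalently, $$\sum_{n\ge 1}M_a(n)q^n=\sum_{0<s_1<\cdots<s_a}\frac{q^{s_1+\cdots+s_a}}{(1-q^{s_1})^2\cdots(1-q^{s_a})^2}.$$ *)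

(* Defs.v *)
From mathcomp Require Import all_boot.

Set Implicit Arguments.
Unset Strict Implicit.
Unset Printing Implicit Defensive.

Definition macmahon_index (a n : nat) (s m : {ffun 'I_a -> 'I_n.+1}) : bool :=
  [&& [forall i, 0 < s i],
      [forall i : 'I_a, forall j : 'I_a, (i < j) ==> (s i < s j)],
      [forall i, 0 < m i]
    & n == \sum_(i < a) m i * s i].

(* Bounding the entries by n loses no tuple: since all s_i and m_i are
   positive, n = \sum_i m_i s_i forces s_i <= n and m_i <= n. *)
Definition macmahon (a n : nat) : nat :=
  \sum_(s : {ffun 'I_a -> 'I_n.+1})
    \sum_(m : {ffun 'I_a -> 'I_n.+1} | macmahon_index s m) \prod_(i < a) m i.

(* Main.v *)
Require Import Defs.
From mathcomp Require Import all_boot all_order all_algebra.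
From mathcomp Require Import zify ring lra.
Import Order.TTheory GRing.Theory Num.Theory.
Local Open Scope ring_scope.

Set Implicit Arguments.
Unset Strict Implicit.
Unset Printing Implicit Defensive.

(** Write x_s = q^s / (1 - q^s)^2, so that the generating function of the k-th
    MacMahon function is the k-th elementary symmetric function of the x_s.
    Newton's identities express it through the power sums of the x_s.  The
    coefficients of the power sums of exponents 1, 2, 3 are combinations of
    divisor sums, namely sigma_1, (sigma_3 - sigma_1) / 6 and
    (sigma_5 - 5 sigma_3 + 4 sigma_1) / 120, so only products of divisor series
    have to be evaluated.  Those are Ramanujan's formulas
      12 (sigma_1 * sigma_1) = 5 sigma_3 + (1 - 6n) sigma_1,
      240 (sigma_3 * sigma_1)
        = 21 sigma_5 + (10 - 30n) sigma_3 - sigma_1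
    for additive convolutions ([ramanujan_sigma1_sigma1],
    [ramanujan_sigma3_sigma1]).  They follow without modular forms from an
    identity of Liouville, valid for every function f,
    which compares the sums of f |a - b| and f (a + b) over all positive
    solutions of a x + b y = n ([liouville]): take f z = z^2 and f z = z^4.
    The only input of that identity is the change of variables
    a x + b y = a (x - y) + (a + b) y.

    The resulting closed forms are
      8 M_2 = (1 - 2n) sigma_1 + sigma_3,
      1920 M_3
        = (40n^2 - 100n + 37) sigma_1 - (30n - 50) sigma_3 + 3 sigma_5,
    and they turn the two expressions of the theorem into
      sum over d | n of d (n^2 - n + 1 - d^2),
      3/2 times the sum over d | n of d (d^2 - 1) (n^2 - d^2).
    In each of them the terms of the divisors 1 and n add up to 0, while every
    divisor strictly between 1 and n contributes a positive term: the sum is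
    nonnegative, and for n >= 2 it vanishes exactly when n has no such divisor
    ([divisor_sum_detects_primes]).

    Sums over solutions are taken over explicit duplicate-free sequences of
    tuples, so that each change of variables is an instance of [big_seq_bij]. *)

(** * Reindexing sums over sequences *)

Lemma big_seq_bij (V : nmodType) (I J : eqType) (r : seq I) (s : seq J)
    (P : pred I) (Q : pred J) (h : I -> J) (h' : J -> I) (F : J -> V) :
    uniq r -> uniq s ->
    (forall i, i \in r -> P i -> [/\ h i \in s, Q (h i) & h' (h i) = i]) ->
    (forall j, j \in s -> Q j -> [/\ h' j \in r, P (h' j) & h (h' j) = j]) ->
  \sum_(j <- s | Q j) F j = \sum_(i <- r | P i) F (h i).
Proof.
move=> Ur Us hP h'P.
rewrite -big_filter -[RHS]big_filter -(big_map h predT F).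
apply: perm_big; apply: uniq_perm.
- exact: filter_uniq.
- rewrite map_inj_in_uniq ?filter_uniq // => i j.
  rewrite !mem_filter => /andP[Pi ri] /andP[Pj rj] eq_h.
  have [_ _ <-] := hP i ri Pi; have [_ _ <-] := hP j rj Pj.
  by rewrite eq_h.
move=> j; rewrite mem_filter; apply/andP/mapP => [[Qj sj] | [i]].
  have [rh Ph <-] := h'P j sj Qj.
  by exists (h' j); rewrite ?mem_filter ?Ph.
by rewrite mem_filter => /andP[Pi ri] ->; have [] := hP i ri Pi.
Qed.

Lemma big_trichotomy (V : nmodType) (I : Type) (r : seq I) (u v : I -> nat)
    (F : I -> V) :
  \sum_(i <- r) F i = \sum_(i <- r | (u i < v i)%N) F i
    + \sum_(i <- r | (v i < u i)%N) F i + \sum_(i <- r | u i == v i) F i.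
Proof.
rewrite [X in _ = X + _ + _]big_mkcond [X in _ = _ + X + _]big_mkcond.
rewrite [X in _ = _ + X]big_mkcond -!big_split; apply: eq_bigr => i _ /=.
by case: ltngtP; rewrite ?addr0 ?add0r.
Qed.

(** * Solutions of sums of products equal to n *)

(** A pair (m, s) stands for a part size s taken with multiplicity m.  The
    divisors are listed by filtering [iota 1 n] so that the sequence is empty for
    n = 0, whereas [divisors 0] is [:: 1]. *)
Definition factorizations (n : nat) : seq (nat * nat) :=
  [seq (d, n %/ d)%N | d <- iota 1 n & (d %| n)%N].

(** The product of two graded families: when [A k] and [B k] list the elements of
    weight k, [convolution A B n] lists the pairs of total weight n. *)
Definition convolution (T U : Type) (A : nat -> seq T) (B : nat -> seq U)
    (n : nat) : seq (T * U) :=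
  [seq t | k <- iota 0 n.+1, t <- [seq (x, y) | x <- A k, y <- B (n - k)%N]].

(** The pairs ((a, x), (b, y)) of positive pairs with a x + b y = n. *)
Definition quads : nat -> seq ((nat * nat) * (nat * nat)) :=
  convolution factorizations factorizations.

Definition hexes : nat -> seq ((nat * nat) * (nat * nat) * (nat * nat)) :=
  convolution quads factorizations.

(** As the range is empty for n = 0, the value there is 0, which makes
    additive convolutions over 0 <= k <= n the usual ones. *)
Definition divisor_sum (k n : nat) : int :=
  \sum_(1 <= d < n.+1 | (d %| n)%N) d%:Z ^+ k.

Lemma mem_factorizations n (p : nat * nat) :
  (p \in factorizations n) = [&& 0 < p.1, 0 < p.2 & p.1 * p.2 == n]%N.
Proof.
case: p => d e /=; apply/mapP/and3P => [[c] | [d_gt0 e_gt0 /eqP <-]].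
  rewrite mem_filter mem_iota add1n ltnS => /and3P[c_n c_gt0 le_cn] [-> ->].
  by rewrite mulnC divnK // c_gt0 divn_gt0 // le_cn eqxx.
exists d; last by rewrite mulKn.
by rewrite mem_filter mem_iota dvdn_mulr // d_gt0 add1n ltnS leq_pmulr.
Qed.

Lemma factorizations_uniq n : uniq (factorizations n).
Proof. by rewrite map_inj_uniq ?filter_uniq ?iota_uniq // => d e []. Qed.

Lemma big_factorizations (V : nmodType) n (F : nat -> V) :
  \sum_(p <- factorizations n) F p.1 = \sum_(1 <= d < n.+1 | (d %| n)%N) F d.
Proof. by rewrite big_map big_filter /index_iota subn1. Qed.

Lemma big_factorizations_swap (V : nmodType) n (F : nat * nat -> V) :
  \sum_(p <- factorizations n) F p = \sum_(p <- factorizations n) F (p.2, p.1).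
Proof.
apply: (big_seq_bij (h := fun p => (p.2, p.1)) (h' := fun p => (p.2, p.1)));
  rewrite ?factorizations_uniq //.
all: by move=> [d e]; rewrite !mem_factorizations /= mulnC => /and3P[-> -> ->].
Qed.

Lemma mem_convolution (T U : eqType) (A : nat -> seq T) (B : nat -> seq U)
    (a : pred T) (b : pred U) (v : T -> nat) (w : U -> nat) n t :
    (forall k x, (x \in A k) = a x && (v x == k)) ->
    (forall k y, (y \in B k) = b y && (w y == k)) ->
  (t \in convolution A B n) = [&& a t.1, b t.2 & (v t.1 + w t.2 == n)%N].
Proof.
move=> AE BE; case: t => x y /=.
apply/(allpairsPdep (T := fun=> (T * U)%type))/and3P;
  first case=> k [_ [k_n /allpairsP[[x' y'] [/= Ax By ->]] [-> ->]]];
  last case=> ax bx /eqP <-.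
  move: Ax By; rewrite AE BE => /andP[-> /eqP->] /andP[-> /eqP->]; split=> //.
  by apply/eqP; apply: subnKC; move: k_n; rewrite mem_iota.
exists (v x), (x, y); split=> //; first by rewrite mem_iota; lia.
by apply/allpairsP; exists (x, y); rewrite AE BE ax bx addKn !eqxx.
Qed.

Lemma convolution_uniq (T U : eqType) (A : nat -> seq T) (B : nat -> seq U)
    (a : pred T) (v : T -> nat) n :
    (forall k x, (x \in A k) = a x && (v x == k)) ->
    (forall k, uniq (A k)) -> (forall k, uniq (B k)) ->
  uniq (convolution A B n).
Proof.
move=> AE UA UB; pose TU (k : nat) : eqType := (T * U)%type.
apply: (@allpairs_uniq_dep _ TU); first exact: iota_uniq.
  by move=> k _; apply: allpairs_uniq => // -[x y] [x' y'] _ _ /= [-> ->].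
move=> i j /(@allpairsPdep _ TU)[k [_ [_ /allpairsP[[x y] [Ax _ ->]] ->]]].
move=> /(@allpairsPdep _ TU)[k' [_ [_ /allpairsP[[x' y'] [Ax' _ ->]] ->]]].
case=> /= eq_x ->; rewrite -{}eq_x /= in Ax Ax' *; move: Ax Ax'; rewrite !AE.
by case/andP=> _ /eqP <- /andP[_ /eqP <-].
Qed.

Lemma big_convolution_dep (V : nmodType) (T U : Type) (A : nat -> seq T)
    (B : nat -> seq U) n (F : T * U -> V) :
  \sum_(t <- convolution A B n) F t
    = \sum_(0 <= k < n.+1) \sum_(x <- A k) \sum_(y <- B (n - k)%N) F (x, y).
Proof.
by rewrite big_allpairs_dep; apply: eq_bigr => k _; rewrite big_allpairs_dep.
Qed.

Lemma big_convolution (R : pzSemiRingType) (T U : Type) (A : nat -> seq T)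
    (B : nat -> seq U) n (F : T -> R) (G : U -> R) :
  \sum_(t <- convolution A B n) F t.1 * G t.2
    = \sum_(0 <= k < n.+1) (\sum_(x <- A k) F x) * (\sum_(y <- B (n - k)%N) G y).
Proof.
rewrite big_convolution_dep; apply: eq_bigr => k _.
by rewrite big_distrl; apply: eq_bigr => x _; rewrite big_distrr.
Qed.

Definition pair_weight (p : nat * nat) : nat := p.1 * p.2.

Definition quad_weight (t : (nat * nat) * (nat * nat)) : nat :=
  pair_weight t.1 + pair_weight t.2.

Definition pair_pos (p : nat * nat) : bool := (0 < p.1)%N && (0 < p.2)%N.

Definition quad_pos (t : (nat * nat) * (nat * nat)) : bool :=
  pair_pos t.1 && pair_pos t.2.

Lemma factorizations_graded n p :
  (p \in factorizations n) = pair_pos p && (pair_weight p == n).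
Proof. by rewrite mem_factorizations andbA. Qed.

Lemma quads_graded n t :
  (t \in quads n) = quad_pos t && (quad_weight t == n).
Proof.
by rewrite (mem_convolution _ _ factorizations_graded factorizations_graded) andbA.
Qed.

Lemma mem_quads n t :
  (t \in quads n) = [&& 0 < t.1.1, 0 < t.1.2, 0 < t.2.1, 0 < t.2.2
                      & t.1.1 * t.1.2 + t.2.1 * t.2.2 == n]%N.
Proof. by rewrite quads_graded -!andbA. Qed.

Lemma mem_hexes n t :
  (t \in hexes n) =
    [&& 0 < t.1.1.1, 0 < t.1.1.2, 0 < t.1.2.1, 0 < t.1.2.2, 0 < t.2.1, 0 < t.2.2
      & t.1.1.1 * t.1.1.2 + t.1.2.1 * t.1.2.2 + t.2.1 * t.2.2 == n]%N.
Proof.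
by rewrite (mem_convolution _ _ quads_graded factorizations_graded) -!andbA.
Qed.

Lemma quads_uniq n : uniq (quads n).
Proof.
apply: convolution_uniq factorizations_graded _ _; exact: factorizations_uniq.
Qed.

Lemma hexes_uniq n : uniq (hexes n).
Proof.
exact: convolution_uniq quads_graded quads_uniq factorizations_uniq.
Qed.

(** * Liouville's identity *)

Lemma big_quads_swap (V : nmodType) n P (F : _ -> V) :
  \sum_(t <- quads n | P t) F t
    = \sum_(t <- quads n | P (t.2, t.1)) F (t.2, t.1).
Proof.
apply: (big_seq_bij (h := fun t => (t.2, t.1)) (h' := fun t => (t.2, t.1)));
  rewrite ?quads_uniq //.
all: move=> [[a x] [b y]]; rewrite !mem_quads /= => in_t P_t; split=> //; lia.
Qed.

Lemma big_quads_transpose (V : nmodType) n P (F : _ -> V) :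
  \sum_(t <- quads n | P t) F t
    = \sum_(t <- quads n | P ((t.1.2, t.1.1), (t.2.2, t.2.1)))
        F ((t.1.2, t.1.1), (t.2.2, t.2.1)).
Proof.
pose h (t : (nat * nat) * (nat * nat)) := ((t.1.2, t.1.1), (t.2.2, t.2.1)).
apply: (big_seq_bij (h := h) (h' := h)); rewrite ?quads_uniq //.
all: move=> [[a x] [b y]]; rewrite !mem_quads /= => in_t P_t; split=> //; lia.
Qed.

(** The change of variables a x + b y = a (x - y) + (a + b) y turns the condition
    y < x on the solutions into the condition a < b. *)
Lemma big_quads_shear (V : nmodType) n (F : _ -> V) :
  \sum_(t <- quads n | (t.1.1 < t.2.1)%N) F t
    = \sum_(t <- quads n | (t.2.2 < t.1.2)%N)
        F ((t.1.1, t.1.2 - t.2.2), (t.1.1 + t.2.1, t.2.2))%N.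
Proof.
apply: (big_seq_bij (P := fun t => (t.2.2 < t.1.2)%N)
  (h := fun t => ((t.1.1, t.1.2 - t.2.2), (t.1.1 + t.2.1, t.2.2))%N)
  (h' := fun t => ((t.1.1, t.1.2 + t.2.2), (t.2.1 - t.1.1, t.2.2))%N));
  rewrite ?quads_uniq //.
  move=> [[a x] [b y]]; rewrite !mem_quads /= => in_t lt_yx.
  have le_yx : (y <= x)%N by exact: ltnW.
  split; [| lia | by rewrite subnK ?addKn].
  have : (a * (x - y) + (a + b) * y = a * x + b * y)%N.
    by rewrite -{2}(subnK le_yx); ring.
  lia.
move=> [[a x] [b y]]; rewrite !mem_quads /= => in_t lt_ab.
have le_ab : (a <= b)%N by exact: ltnW.
split; [| lia | by rewrite addnK subnKC].
have : (a * (x + y) + (b - a) * y = a * x + b * y)%N.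
  by rewrite -{2}(subnK le_ab); ring.
lia.
Qed.

(** Split the first sum on the left according to the order of a and b, and the
    first sum on the right according to the order of x and y.  By the
    shear and the exchange of the two pairs, the sum of f |a - b| over a <> b is
    twice the sum of f b over y < x, while the sum of f (a + b) over x <> y is
    twice the sum of f b over a < b.  The difference of these sums of f b is
    found by splitting the sum of f b over all solutions in both ways. *)
Lemma liouville n (f : nat -> int) :
  \sum_(t <- quads n) f (t.1.1 - t.2.1 + (t.2.1 - t.1.1))%N
    + \sum_(t <- quads n | t.1.2 == t.2.2) (f (t.1.1 + t.2.1)%N + 2 * f t.2.1)
  = \sum_(t <- quads n) f (t.1.1 + t.2.1)%N
    + \sum_(t <- quads n | t.1.1 == t.2.1) (f 0%N + 2 * f t.2.1).
Proof.
have eq_lt_diff : \sum_(t <- quads n | (t.1.1 < t.2.1)%N)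
      f (t.1.1 - t.2.1 + (t.2.1 - t.1.1))%N
    = \sum_(t <- quads n | (t.2.2 < t.1.2)%N) f t.2.1.
  rewrite big_quads_shear; apply: eq_bigr => t _ /=; congr f; lia.
have eq_gt_diff : \sum_(t <- quads n | (t.2.1 < t.1.1)%N)
      f (t.1.1 - t.2.1 + (t.2.1 - t.1.1))%N
    = \sum_(t <- quads n | (t.2.2 < t.1.2)%N) f t.2.1.
  rewrite -eq_lt_diff big_quads_swap; apply: eq_bigr => t _ /=.
  by rewrite addnC.
have eq_diff : \sum_(t <- quads n | t.1.1 == t.2.1)
      f (t.1.1 - t.2.1 + (t.2.1 - t.1.1))%N
    = \sum_(t <- quads n | t.1.1 == t.2.1) f 0%N.
  by apply: eq_bigr => t /eqP ->; rewrite subnn.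
have eq_gt_sum : \sum_(t <- quads n | (t.2.2 < t.1.2)%N) f (t.1.1 + t.2.1)%N
    = \sum_(t <- quads n | (t.1.1 < t.2.1)%N) f t.2.1.
  by rewrite big_quads_shear.
have eq_lt_sum : \sum_(t <- quads n | (t.1.2 < t.2.2)%N) f (t.1.1 + t.2.1)%N
    = \sum_(t <- quads n | (t.1.1 < t.2.1)%N) f t.2.1.
  rewrite -eq_gt_sum big_quads_swap; apply: eq_bigr => t _ /=.
  by rewrite addnC.
have eq_swap : \sum_(t <- quads n | (t.2.1 < t.1.1)%N) f t.2.1
    = \sum_(t <- quads n | (t.1.2 < t.2.2)%N) f t.2.1.
  by rewrite big_quads_swap big_quads_shear big_quads_swap.
have := big_trichotomy (quads n) (fun t => t.1.1) (fun t => t.2.1)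
  (fun t => f t.2.1).
rewrite (big_trichotomy (quads n) (fun t => t.1.2) (fun t => t.2.2)
  (fun t => f t.2.1)).
rewrite (big_trichotomy _ (fun t => t.1.1) (fun t => t.2.1)
  (fun t => f (t.1.1 - t.2.1 + (t.2.1 - t.1.1))%N)).
rewrite (big_trichotomy _ (fun t => t.1.2) (fun t => t.2.2)
  (fun t => f (t.1.1 + t.2.1)%N)) !big_split /= -!mulr_sumr.
rewrite eq_lt_diff eq_gt_diff eq_diff eq_gt_sum eq_lt_sum eq_swap.
move=> eq_b; lra.
Qed.

(** If both sizes equal s then (a + b) s = n: such a solution is a factorization of
    n together with a decomposition of its first factor. *)
Lemma big_quads_diagonal (V : nmodType) n (F : _ -> V) :
  \sum_(t <- quads n | t.1.2 == t.2.2) F t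
    = \sum_(p <- factorizations n) \sum_(1 <= z < p.1)
        F ((z, p.2), (p.1 - z, p.2))%N.
Proof.
pose r := [seq (p, z) | p <- factorizations n, z <- iota 1 p.1.-1].
pose h (u : nat * nat * nat) := ((u.2, u.1.2), (u.1.1 - u.2, u.1.2))%N.
pose h' (t : (nat * nat) * (nat * nat)) := ((t.1.1 + t.2.1)%N, t.1.2, t.1.1).
have mem_r u : (u \in r) = (u.1 \in factorizations n) && (0 < u.2 < u.1.1)%N.
  case: u => p z; apply/allpairsPdep/andP => /= [[q [y [q_n y_q [-> ->]]]]|].
    by rewrite mem_iota in y_q; split=> //; lia.
  by case=> p_n z_p; exists p, z; rewrite mem_iota; split=> //; lia.
transitivity (\sum_(u <- r) F (h u)); last first.
  rewrite big_allpairs_dep; apply: eq_bigr => p _.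
  by rewrite /index_iota subn1.
apply: (big_seq_bij (P := predT) (h' := h')); rewrite ?quads_uniq //.
- apply: allpairs_uniq_dep; rewrite ?factorizations_uniq //.
    by move=> *; rewrite iota_uniq.
  by move=> [p z] [q y] _ _ /= [-> ->].
- case=> [[d e] z]; rewrite mem_r mem_factorizations mem_quads /= => dez _.
  have le_zd : (z <= d)%N by lia.
  have : (z * e + (d - z) * e = d * e)%N by rewrite -mulnDl (subnKC le_zd).
  by rewrite /h' /= (subnKC le_zd); split=> //; lia.
case=> [[a x] [b y]]; rewrite mem_r mem_factorizations mem_quads /=.
move=> t_n /eqP eq_xy.
have := mulnDl a b x; rewrite /h /= addKn -eq_xy; split=> //; lia.
Qed.

(** * Power sums *)

Lemma sum_differences (V : zmodType) (F G : nat -> V) d :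
    G 0%N = 0 -> G 1%N = 0 -> (forall z, F z = G z.+1 - G z) ->
  \sum_(1 <= z < d) F z = G d.
Proof.
move=> G0 G1 GE; case: d => [|d]; first by rewrite big_geq.
by rewrite (eq_bigr _ (fun z _ => GE z)) telescope_sumr // G1 subr0.
Qed.

Lemma sum_powers_1 (d : nat) : 2 * \sum_(1 <= z < d) z%:Z = d%:Z ^+ 2 - d%:Z.
Proof.
rewrite mulr_sumr.
apply: (sum_differences (G := fun d => d%:Z ^+ 2 - d%:Z)) => // z.
ring.
Qed.

Lemma sum_powers_2 (d : nat) :
  6 * \sum_(1 <= z < d) z%:Z ^+ 2 = 2 * d%:Z ^+ 3 - 3 * d%:Z ^+ 2 + d%:Z.
Proof.
rewrite mulr_sumr; apply: (sum_differences
  (G := fun d => 2 * d%:Z ^+ 3 - 3 * d%:Z ^+ 2 + d%:Z)) => // z.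
ring.
Qed.

Lemma sum_powers_3 (d : nat) :
  4 * \sum_(1 <= z < d) z%:Z ^+ 3 = d%:Z ^+ 4 - 2 * d%:Z ^+ 3 + d%:Z ^+ 2.
Proof.
rewrite mulr_sumr; apply: (sum_differences
  (G := fun d => d%:Z ^+ 4 - 2 * d%:Z ^+ 3 + d%:Z ^+ 2)) => // z.
ring.
Qed.

Lemma sum_powers_4 (d : nat) :
  30 * \sum_(1 <= z < d) z%:Z ^+ 4
    = 6 * d%:Z ^+ 5 - 15 * d%:Z ^+ 4 + 10 * d%:Z ^+ 3 - d%:Z.
Proof.
rewrite mulr_sumr; apply: (sum_differences (G := fun d =>
  6 * d%:Z ^+ 5 - 15 * d%:Z ^+ 4 + 10 * d%:Z ^+ 3 - d%:Z)) => // z.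
ring.
Qed.

(** This evaluates x_s^2: the coefficient of q^(d s) is the sum of the products
    of the two parts of d, that is C(d + 1, 3). *)
Lemma sum_composition_mul d :
  6 * \sum_(1 <= z < d) z%:Z * (d%:Z - z%:Z) = d%:Z ^+ 3 - d%:Z.
Proof.
have -> : \sum_(1 <= z < d) z%:Z * (d%:Z - z%:Z)
    = d%:Z * \sum_(1 <= z < d) z%:Z - \sum_(1 <= z < d) z%:Z ^+ 2.
  by rewrite mulr_sumr -sumrB; apply: eq_bigr => z _; ring.
have := congr1 ( *%R (3 * d%:Z)) (sum_powers_1 d); have := sum_powers_2 d; lra.
Qed.

(** * Ramanujan's convolutions of divisor sums *)

Lemma sum_factorizations_fst k n :
  \sum_(p <- factorizations n) p.1%:Z ^+ k = divisor_sum k n.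
Proof. exact: (big_factorizations n (fun d => d%:Z ^+ k)). Qed.

Lemma sum_factorizations_snd k n :
  \sum_(p <- factorizations n) p.2%:Z ^+ k = divisor_sum k n.
Proof. by rewrite big_factorizations_swap sum_factorizations_fst. Qed.

Lemma sum_quads_pow j k n :
  \sum_(t <- quads n) t.1.1%:Z ^+ j * t.2.1%:Z ^+ k
    = \sum_(0 <= i < n.+1) divisor_sum j i * divisor_sum k (n - i).
Proof.
rewrite (big_convolution _ _ _ (fun p => p.1%:Z ^+ j) (fun p => p.1%:Z ^+ k)).
by apply: eq_bigr => i _; rewrite !sum_factorizations_fst.
Qed.

Lemma sum_quads_eq_mult k n :
  \sum_(t <- quads n | t.1.1 == t.2.1) t.2.1%:Z ^+ k.+1
    = n%:Z * divisor_sum k n - divisor_sum k.+1 n.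
Proof.
rewrite big_quads_transpose big_quads_diagonal -!sum_factorizations_snd.
rewrite mulr_sumr -sumrB; apply: eq_big_seq => p.
rewrite mem_factorizations => /and3P[p1_gt0 _ /eqP <-].
rewrite /= big_const_nat iter_addr_0 -[_ *+ (_ - _)]mulr_natl natz -subzn //.
by rewrite PoszM exprS; ring.
Qed.

Lemma sum_quads_eq_size (V : nmodType) n (F : nat -> nat -> V) :
  \sum_(t <- quads n | t.1.2 == t.2.2) F t.1.1 (t.1.1 + t.2.1)%N
    = \sum_(1 <= d < n.+1 | (d %| n)%N) \sum_(1 <= z < d) F z d.
Proof.
rewrite big_quads_diagonal -(big_factorizations _ (fun d => \sum_(1 <= z < d) F z d)).
apply: eq_bigr => p _; apply: eq_big_nat => z /andP[_ lt_zp].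
by rewrite /= subnKC // ltnW.
Qed.

Lemma sum_quads_eq_size_pow k n :
  \sum_(t <- quads n | t.1.2 == t.2.2)
      ((t.1.1 + t.2.1)%:Z ^+ k + 2 * t.2.1%:Z ^+ k)
    = \sum_(1 <= d < n.+1 | (d %| n)%N)
        ((d%:Z - 1) * d%:Z ^+ k + 2 * \sum_(1 <= z < d) z%:Z ^+ k).
Proof.
rewrite big_quads_swap /=.
under eq_bigl => t do rewrite eq_sym.
under eq_bigr => t _ do rewrite addnC.
rewrite (sum_quads_eq_size n (fun z d => d%:Z ^+ k + 2 * z%:Z ^+ k)).
rewrite big_seq_cond [RHS]big_seq_cond; apply: eq_bigr => d.
rewrite mem_index_iota => /andP[/andP[d_gt0 _] _].
rewrite big_split /= -mulr_sumr big_const_nat iter_addr_0.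
by rewrite -[_ *+ (_ - _)]mulr_natl natz -subzn.
Qed.

Lemma distn_pow_even (a b k : nat) :
  ((a - b + (b - a))%N)%:Z ^+ k.*2 = (a%:Z - b%:Z) ^+ k.*2.
Proof.
rewrite -muln2 mulnC !exprM; congr (_ ^+ k).
case: (leqP a b) => [le_ab | /ltnW le_ba].
  by rewrite (eqP le_ab) add0n -subzn // -sqrrN opprB.
by rewrite (eqP le_ba) addn0 -subzn.
Qed.

(** Liouville's identity for f z = z^2, since (a + b)^2 - (a - b)^2 = 4ab. *)
Lemma ramanujan_sigma1_sigma1 n :
  12 * \sum_(t <- quads n) t.1.1%:Z * t.2.1%:Z
    = 5 * divisor_sum 3 n + (1 - 6 * n%:Z) * divisor_sum 1 n.
Proof.
have := liouville n (fun z => z%:Z ^+ 2).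
rewrite sum_quads_eq_size_pow.
under eq_bigr => t _ do rewrite (distn_pow_even _ _ 1).
under [X in _ = _ + X]eq_bigr => t _ do rewrite /= expr0n add0r.
rewrite -mulr_sumr sum_quads_eq_mult.
have -> : \sum_(t <- quads n) (t.1.1 + t.2.1)%:Z ^+ 2
    = \sum_(t <- quads n) (t.1.1%:Z - t.2.1%:Z) ^+ 2
      + 4 * \sum_(t <- quads n) t.1.1%:Z * t.2.1%:Z.
  by rewrite mulr_sumr -big_split; apply: eq_bigr => t _ /=; rewrite PoszD; ring.
have : 3 * \sum_(1 <= d < n.+1 | (d %| n)%N)
        ((d%:Z - 1) * d%:Z ^+ 2 + 2 * \sum_(1 <= z < d) z%:Z ^+ 2)
    = 5 * divisor_sum 3 n - 6 * divisor_sum 2 n + divisor_sum 1 n.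
  rewrite /divisor_sum !mulr_sumr -sumrB -big_split /=; apply: eq_bigr => d _.
  have := sum_powers_2 d; lra.
lra.
Qed.

(** Liouville's identity for f z = z^4, since
    (a + b)^4 - (a - b)^4 = 8 (a^3 b + a b^3) and both terms have the same sum. *)
Lemma ramanujan_sigma3_sigma1 n :
  240 * \sum_(t <- quads n) t.1.1%:Z ^+ 3 * t.2.1%:Z
    = 21 * divisor_sum 5 n + (10 - 30 * n%:Z) * divisor_sum 3 n - divisor_sum 1 n.
Proof.
have := liouville n (fun z => z%:Z ^+ 4).
rewrite sum_quads_eq_size_pow.
under eq_bigr => t _ do rewrite (distn_pow_even _ _ 2).
under [X in _ = _ + X]eq_bigr => t _ do rewrite /= expr0n add0r.
rewrite -mulr_sumr sum_quads_eq_mult.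
have swap31 : \sum_(t <- quads n) t.1.1%:Z * t.2.1%:Z ^+ 3
    = \sum_(t <- quads n) t.1.1%:Z ^+ 3 * t.2.1%:Z.
  by rewrite big_quads_swap; apply: eq_bigr => t _; rewrite mulrC.
have -> : \sum_(t <- quads n) (t.1.1 + t.2.1)%:Z ^+ 4
    = \sum_(t <- quads n) (t.1.1%:Z - t.2.1%:Z) ^+ 4
      + 16 * \sum_(t <- quads n) t.1.1%:Z ^+ 3 * t.2.1%:Z.
  suff -> : 16 * \sum_(t <- quads n) t.1.1%:Z ^+ 3 * t.2.1%:Z
      = 8 * \sum_(t <- quads n) t.1.1%:Z ^+ 3 * t.2.1%:Z
        + 8 * \sum_(t <- quads n) t.1.1%:Z * t.2.1%:Z ^+ 3.
    rewrite !mulr_sumr -!big_split; apply: eq_bigr => t _ /=; rewrite PoszD; ring.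
  by rewrite swap31; ring.
have : 15 * \sum_(1 <= d < n.+1 | (d %| n)%N)
        ((d%:Z - 1) * d%:Z ^+ 4 + 2 * \sum_(1 <= z < d) z%:Z ^+ 4)
    = 21 * divisor_sum 5 n - 30 * divisor_sum 4 n + 10 * divisor_sum 3 n
      - divisor_sum 1 n.
  rewrite /divisor_sum !mulr_sumr -!sumrB -!big_split /= -sumrB.
  apply: eq_bigr => d _.
  have := sum_powers_4 d; lra.
lra.
Qed.

(** * MacMahon's function as a sum over ordered solutions *)

(** The index set of MacMahon's function, encoded by the list of the pairs
    (m_i, s_i) instead of two finite functions. *)
Definition macmahon_list (a n : nat) : pred (seq (nat * nat)) := fun l =>
  [&& size l == a, all pair_pos l, sorted ltn [seq p.2 | p <- l]
    & (\sum_(p <- l) pair_weight p)%N == n].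

Lemma macmahon_list_bounds a n l p : macmahon_list a n l -> p \in l ->
  [/\ 0 < p.1, 0 < p.2, p.1 <= n & p.2 <= n]%N.
Proof.
case/and4P=> _ /allP l_gt0 _ /eqP <- p_l.
have /andP[p1_gt0 p2_gt0] := l_gt0 p p_l; split=> //.
all: rewrite (big_rem p) //=; apply: leq_trans (leq_addr _ _).
  by rewrite leq_pmulr.
by rewrite leq_pmull.
Qed.

(** Reading off the lists of pairs (m_i, s_i) is a bijection between the two
    index sets; truncation by n is harmless because of [macmahon_list_bounds]. *)
Lemma macmahonE a n (r : seq (seq (nat * nat))) :
    uniq r -> (forall l, (l \in r) = macmahon_list a n l) ->
  macmahon a n = (\sum_(l <- r) \prod_(p <- l) p.1)%N.
Proof.
move=> Ur rE; pose ffs := {ffun 'I_a -> 'I_n.+1}.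
pose h (q : ffs * ffs) := [seq (val (q.2 i), val (q.1 i)) | i <- enum 'I_a].
pose h' (l : seq (nat * nat)) : ffs * ffs :=
  ([ffun i : 'I_a => inord (nth (0, 0)%N l i).2],
   [ffun i : 'I_a => inord (nth (0, 0)%N l i).1]).
have nth_h q (i : 'I_a) : nth (0, 0)%N (h q) i = (val (q.2 i), val (q.1 i)).
  by rewrite (nth_map i) ?size_enum_ord // nth_ord_enum.
have size_h q : size (h q) = a by rewrite size_map size_enum_ord.
rewrite /macmahon pair_big_dep /=.
rewrite [RHS](@big_seq_bij _ _ _ (index_enum _) _
  (fun q => macmahon_index q.1 q.2)
  predT h h') //; first last.
- move=> l; rewrite rE => l_ok _.
  have /and4P[/eqP sz_l l_gt0 l_lt /eqP l_n] := l_ok.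
  have bnd (i : 'I_a) := macmahon_list_bounds l_ok (mem_nth (0, 0)%N
    (eq_ind_r (fun k => i < k)%N (ltn_ord i) sz_l)).
  have h'K : h (h' l) = l.
    apply: (@eq_from_nth _ (0, 0)%N); rewrite size_h // => i lt_ia.
    have := bnd (Ordinal lt_ia); rewrite (nth_h _ (Ordinal lt_ia)) /= !ffunE /=.
    by case: (nth _ l i) => m s [_ _ /= le_m le_s]; rewrite !inordK.
  have val_m i : val ((h' l).2 i) = (nth (0, 0)%N l i).1 by rewrite -{2}h'K nth_h.
  have val_s i : val ((h' l).1 i) = (nth (0, 0)%N l i).2 by rewrite -{2}h'K nth_h.
  split; rewrite ?mem_index_enum //; apply/and4P; split.
  + by apply/forallP=> i; rewrite val_s; case: (bnd i).
  + apply/forallP=> i; apply/forallP=> j; apply/implyP=> lt_ij.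
    rewrite !val_s -!(nth_map (0, 0)%N 0%N snd) ?sz_l //.
    by apply: (sorted_ltn_nth ltn_trans) => //; rewrite inE size_map sz_l.
  + by apply/forallP=> i; rewrite val_m; case: (bnd i).
  rewrite -{1}l_n -{1}h'K big_map big_enum.
  by apply/eqP; apply: eq_bigr => i _.
- move=> [s m] _ /and4P[/forallP s_gt0 /forallP s_lt /forallP m_gt0 /eqP def_n].
  split=> //; last first.
    by congr (_, _); apply/ffunP=> i; rewrite ffunE nth_h inord_val.
  rewrite rE; apply/and4P; split; first by rewrite size_h.
  + by apply/allP=> _ /mapP[i _ ->]; rewrite /pair_pos s_gt0 m_gt0.
  + apply/(sortedP 0%N) => i; rewrite size_map size_h => lt_ia.
    rewrite !(nth_map (0, 0)%N) ?size_h //; last exact: ltnW.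
    rewrite (nth_h _ (Ordinal lt_ia)) (nth_h _ (Ordinal (ltnW lt_ia))) /=.
    have /forallP/(_ (Ordinal lt_ia))/implyP := s_lt (Ordinal (ltnW lt_ia)).
    by apply.
  by rewrite big_map big_enum /= [n in _ == n]def_n.
- exact: index_enum_uniq.
by apply: eq_bigr => q _; rewrite big_map big_enum.
Qed.

Lemma macmahon_1 n : (macmahon 1 n)%:Z = divisor_sum 1 n.
Proof.
rewrite (@macmahonE _ _ [seq [:: p] | p <- factorizations n]).
- rewrite big_map -sum_factorizations_fst -natz natr_sum.
  by apply: eq_bigr => p _; rewrite big_seq1 natz.
- by rewrite map_inj_uniq ?factorizations_uniq // => p q [].
move=> l; apply/mapP/and4P => [[p] | []].
  by rewrite factorizations_graded => /andP[p_gt0 p_n] ->; rewrite /= big_seq1 p_gt0.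
case: l => [|p []] //= _ p_gt0 _; rewrite big_seq1 => p_n.
by exists p; rewrite // factorizations_graded p_n andbT; case/andP: p_gt0.
Qed.

Lemma macmahon_2 n :
  (macmahon 2 n)%:Z
    = \sum_(t <- quads n | (t.1.2 < t.2.2)%N) t.1.1%:Z * t.2.1%:Z.
Proof.
rewrite (@macmahonE _ _ [seq [:: t.1; t.2] | t <- quads n & (t.1.2 < t.2.2)%N]).
- rewrite big_map big_filter -natz natr_sum.
  by apply: eq_bigr => t _; rewrite !big_cons big_nil muln1 natz.
- by rewrite map_inj_uniq ?filter_uniq ?quads_uniq // => -[p q] [p' q'] /= [-> ->].
move=> l; apply/mapP/and4P => [[t] | []].
  rewrite mem_filter quads_graded => /and3P[lt_t /andP[p_gt0 q_gt0] t_n] ->.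
  by rewrite /= p_gt0 q_gt0 lt_t !big_cons big_nil addn0.
case: l => [|p [|q []]] //= _ /and3P[p_gt0 q_gt0 _] /andP[lt_pq _].
rewrite !big_cons big_nil addn0 => pq_n.
by exists (p, q); rewrite // mem_filter quads_graded /quad_pos /= lt_pq p_gt0 q_gt0.
Qed.

Lemma macmahon_3 n :
  (macmahon 3 n)%:Z
    = \sum_(t <- hexes n | (t.1.1.2 < t.1.2.2)%N && (t.1.2.2 < t.2.2)%N)
        t.1.1.1%:Z * t.1.2.1%:Z * t.2.1%:Z.
Proof.
rewrite (@macmahonE _ _ [seq [:: t.1.1; t.1.2; t.2]
  | t <- hexes n & (t.1.1.2 < t.1.2.2)%N && (t.1.2.2 < t.2.2)%N]).
- rewrite big_map big_filter -natz natr_sum.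
  by apply: eq_bigr => t _; rewrite !big_cons big_nil muln1 natz !PoszM mulrA.
- rewrite map_inj_uniq ?filter_uniq ?hexes_uniq // => -[[p q] u] [[p' q'] u'] /=.
  by case=> -> -> ->.
have mem_h t : (t \in hexes n) = [&& pair_pos t.1.1, pair_pos t.1.2, pair_pos t.2
    & (pair_weight t.1.1 + (pair_weight t.1.2 + pair_weight t.2))%N == n].
  by rewrite mem_hexes addnA -!andbA.
move=> l; apply/mapP/and4P => [[t] | []].
  rewrite mem_filter mem_h => /andP[/andP[lt1 lt2] /and4P[p_gt0 q_gt0 u_gt0 t_n]].
  move=> ->.
  by rewrite /= p_gt0 q_gt0 u_gt0 lt1 lt2 !big_cons big_nil addn0.
case: l => [|p [|q [|u []]]] //= _ /and4P[p_gt0 q_gt0 u_gt0 _] /and3P[lt1 lt2 _].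
rewrite !big_cons big_nil addn0 => pqu_n; exists ((p, q), u) => //.
by rewrite mem_filter mem_h /= lt1 lt2 p_gt0 q_gt0 u_gt0.
Qed.

(** * Closed forms of MacMahon's functions *)

Lemma sum_quads_eq_size_mul n :
  6 * \sum_(t <- quads n | t.1.2 == t.2.2) t.1.1%:Z * t.2.1%:Z
    = divisor_sum 3 n - divisor_sum 1 n.
Proof.
transitivity (6 * \sum_(t <- quads n | t.1.2 == t.2.2)
    t.1.1%:Z * ((t.1.1 + t.2.1)%:Z - t.1.1%:Z)).
  by congr (_ * _); apply: eq_bigr => t _; rewrite PoszD; ring.
rewrite (sum_quads_eq_size n (fun z d => z%:Z * (d%:Z - z%:Z))).
rewrite mulr_sumr -sumrB; apply: eq_bigr => d _.
exact: sum_composition_mul.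
Qed.

(** This is 2 e_2 = p_1^2 - p_2: of all solutions, those with x < y and those
    with y < x contribute M_2 each, and those with x = y the remaining term. *)
Lemma macmahon_2_closed n :
  8 * (macmahon 2 n)%:Z = (1 - 2 * n%:Z) * divisor_sum 1 n + divisor_sum 3 n.
Proof.
have := ramanujan_sigma1_sigma1 n; have := sum_quads_eq_size_mul n.
rewrite (big_trichotomy _ (fun t => t.1.2) (fun t => t.2.2)) /=.
have -> : \sum_(t <- quads n | (t.2.2 < t.1.2)%N) t.1.1%:Z * t.2.1%:Z
    = (macmahon 2 n)%:Z.
  by rewrite macmahon_2 big_quads_swap; apply: eq_bigr => t _; rewrite mulrC.
rewrite -macmahon_2; lra.
Qed.

(** Same splitting as in [big_quads_diagonal], applied to the first two pairs: the
    solution is determined by the quadruple obtained by merging them. *)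
Lemma big_hexes_diagonal n (F : _ -> int) :
  \sum_(t <- hexes n | t.1.1.2 == t.1.2.2) F t
    = \sum_(t <- quads n) \sum_(1 <= z < t.1.1)
        F (((z, t.1.2), (t.1.1 - z, t.1.2)), t.2)%N.
Proof.
rewrite big_mkcond /= big_convolution_dep [RHS]big_convolution_dep.
apply: eq_bigr => k _.
transitivity (\sum_(q <- quads k | q.1.2 == q.2.2)
    \sum_(u <- factorizations (n - k)) F (q, u)).
  rewrite [RHS]big_mkcond; apply: eq_bigr => q _ /=.
  by case: eqP => // _; rewrite big1.
by rewrite big_quads_diagonal; apply: eq_bigr => p _; rewrite exchange_big.
Qed.

Definition hex_mul (t : (nat * nat) * (nat * nat) * (nat * nat)) : int :=
  t.1.1.1%:Z * t.1.2.1%:Z * t.2.1%:Z.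

(** The coefficient of p_1^3.  One factor p_1^2 is replaced by its closed form;
    this creates the convolution of n sigma_1 with sigma_1, which by symmetry is
    n / 2 times the convolution of sigma_1 with itself. *)
Lemma sum_hexes_mul n :
  12 * \sum_(t <- hexes n) hex_mul t
    = 5 * \sum_(t <- quads n) t.1.1%:Z ^+ 3 * t.2.1%:Z
      + (1 - 3 * n%:Z) * \sum_(t <- quads n) t.1.1%:Z * t.2.1%:Z.
Proof.
rewrite (sum_quads_pow 3 1) (sum_quads_pow 1 1).
rewrite (big_convolution _ _ _ (fun q => q.1.1%:Z * q.2.1%:Z) (fun p => p.1%:Z)).
under eq_bigr => k _ do rewrite (sum_factorizations_fst 1).
have moment : 2 * \sum_(0 <= k < n.+1)
      k%:Z * (divisor_sum 1 k * divisor_sum 1 (n - k))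
    = n%:Z * \sum_(0 <= k < n.+1) divisor_sum 1 k * divisor_sum 1 (n - k).
  rewrite mulr2n mulrDl !mul1r {2}big_nat_rev -big_split mulr_sumr.
  apply: eq_big_nat => k /andP[_ le_kn] /=.
  rewrite add0n subSS subKn // -subzn //; ring.
have -> : 12 * \sum_(0 <= k < n.+1)
      (\sum_(q <- quads k) q.1.1%:Z * q.2.1%:Z) * divisor_sum 1 (n - k)
    = 5 * \sum_(0 <= k < n.+1) divisor_sum 3 k * divisor_sum 1 (n - k)
      + \sum_(0 <= k < n.+1) divisor_sum 1 k * divisor_sum 1 (n - k)
      - 6 * \sum_(0 <= k < n.+1)
          k%:Z * (divisor_sum 1 k * divisor_sum 1 (n - k)).
  rewrite !mulr_sumr -big_split -sumrB; apply: eq_bigr => k _ /=.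
  by rewrite mulrA ramanujan_sigma1_sigma1; ring.
lra.
Qed.

(** The coefficient of p_2 p_1. *)
Lemma sum_hexes_eq2 n :
  6 * \sum_(t <- hexes n | t.1.1.2 == t.1.2.2) hex_mul t
    = \sum_(t <- quads n) (t.1.1%:Z ^+ 3 - t.1.1%:Z) * t.2.1%:Z.
Proof.
rewrite big_hexes_diagonal mulr_sumr; apply: eq_bigr => t _.
rewrite -sum_composition_mul -mulrA mulr_suml; congr (_ * _).
by apply: eq_big_nat => z /andP[_ lt_zt]; rewrite /hex_mul /= -subzn // ltnW.
Qed.

(** The coefficient of p_3: merge the first two pairs, and then the result with
    the third one. *)
Lemma sum_hexes_eq3 n :
  120 * \sum_(t <- hexes n | (t.1.1.2 == t.1.2.2) && (t.1.2.2 == t.2.2))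
      hex_mul t
    = divisor_sum 5 n - 5 * divisor_sum 3 n + 4 * divisor_sum 1 n.
Proof.
have -> : 120 * \sum_(t <- hexes n |
      (t.1.1.2 == t.1.2.2) && (t.1.2.2 == t.2.2)) hex_mul t
    = 20 * \sum_(t <- quads n | t.1.2 == t.2.2)
        (t.1.1%:Z ^+ 3 - t.1.1%:Z) * ((t.1.1 + t.2.1)%:Z - t.1.1%:Z).
  rewrite big_mkcondr big_hexes_diagonal [in RHS]big_mkcond !mulr_sumr.
  apply: eq_bigr => t _ /=; case: eqP => _; last by rewrite big1 // !mulr0.
  rewrite -sum_composition_mul PoszD.
  have -> : \sum_(1 <= z < t.1.1) hex_mul ((z, t.1.2), ((t.1.1 - z)%N, t.1.2), t.2)
      = (\sum_(1 <= z < t.1.1) z%:Z * (t.1.1%:Z - z%:Z)) * t.2.1%:Z.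
    rewrite mulr_suml.
    by apply: eq_big_nat => z /andP[_ lt_zt]; rewrite /hex_mul /= -subzn // ltnW.
  ring.
rewrite (sum_quads_eq_size n (fun z d => (z%:Z ^+ 3 - z%:Z) * (d%:Z - z%:Z))).
rewrite !mulr_sumr -sumrB -big_split; apply: eq_bigr => d _ /=.
have -> : \sum_(1 <= z < d) (z%:Z ^+ 3 - z%:Z) * (d%:Z - z%:Z)
    = d%:Z * \sum_(1 <= z < d) z%:Z ^+ 3 - \sum_(1 <= z < d) z%:Z ^+ 4
      - \sum_(1 <= z < d) z%:Z * (d%:Z - z%:Z).
  by rewrite mulr_sumr -!sumrB; apply: eq_bigr => z _; ring.
have := congr1 ( *%R d%:Z) (sum_powers_3 d); have := sum_powers_4 d.
have := sum_composition_mul d; lra.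
Qed.

Lemma big_hexes_swap12 (V : nmodType) n P (F : _ -> V) :
  \sum_(t <- hexes n | P t) F t
    = \sum_(t <- hexes n | P ((t.1.2, t.1.1), t.2)) F ((t.1.2, t.1.1), t.2).
Proof.
pose h (t : (nat * nat) * (nat * nat) * (nat * nat)) := ((t.1.2, t.1.1), t.2).
apply: (big_seq_bij (h := h) (h' := h)); rewrite ?hexes_uniq //.
all: move=> [[[a x] [b y]] [c z]]; rewrite !mem_hexes /= => in_t P_t.
all: by split=> //; lia.
Qed.

Lemma big_hexes_swap23 (V : nmodType) n P (F : _ -> V) :
  \sum_(t <- hexes n | P t) F t
    = \sum_(t <- hexes n | P ((t.1.1, t.2), t.1.2)) F ((t.1.1, t.2), t.1.2).
Proof.
pose h (t : (nat * nat) * (nat * nat) * (nat * nat)) := ((t.1.1, t.2), t.1.2).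
apply: (big_seq_bij (h := h) (h' := h)); rewrite ?hexes_uniq //.
all: move=> [[[a x] [b y]] [c z]]; rewrite !mem_hexes /= => in_t P_t.
all: by split=> //; lia.
Qed.

Lemma sum_hexes_mul_swap12 n P :
  \sum_(t <- hexes n | P t.1.1.2 t.1.2.2 t.2.2) hex_mul t
    = \sum_(t <- hexes n | P t.1.2.2 t.1.1.2 t.2.2) hex_mul t.
Proof.
by rewrite big_hexes_swap12; apply: eq_bigr => t _; rewrite /hex_mul /=; ring.
Qed.

Lemma sum_hexes_mul_swap23 n P :
  \sum_(t <- hexes n | P t.1.1.2 t.1.2.2 t.2.2) hex_mul t
    = \sum_(t <- hexes n | P t.1.1.2 t.2.2 t.1.2.2) hex_mul t.
Proof.
by rewrite big_hexes_swap23; apply: eq_bigr => t _; rewrite /hex_mul /=; ring.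
Qed.

(** This is 6 e_3 = p_1^3 - 3 p_1 p_2 + 2 p_3, obtained by counting: a triple of
    sizes is in exactly one of the six strict orders, or has one coincidence
    among its three pairs, or has all three of them, in which case it must be
    discounted twice.  As the summand is symmetric, the six orders contribute
    equally, and so do the three coincidences. *)
Lemma macmahon_3_newton n :
  6 * (macmahon 3 n)%:Z
    = \sum_(t <- hexes n) hex_mul t
      - 3 * \sum_(t <- hexes n | t.1.1.2 == t.1.2.2) hex_mul t
      + 2 * \sum_(t <- hexes n | (t.1.1.2 == t.1.2.2) && (t.1.2.2 == t.2.2))
          hex_mul t.
Proof.
pose S (P : nat -> nat -> nat -> bool) :=
  \sum_(t <- hexes n | P t.1.1.2 t.1.2.2 t.2.2) hex_mul t.
have S12 P : S P = S (fun x y z => P y x z) by apply: sum_hexes_mul_swap12.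
have S23 P : S P = S (fun x y z => P x z y) by apply: sum_hexes_mul_swap23.
pose lt3 x y z := (x < y)%N && (y < z)%N.
have lt3_213 : S (fun x y z => lt3 y x z) = S lt3 by rewrite (S12 lt3).
have lt3_132 : S (fun x y z => lt3 x z y) = S lt3 by rewrite (S23 lt3).
have lt3_312 : S (fun x y z => lt3 z x y) = S lt3 by rewrite -lt3_213 S23.
have lt3_231 : S (fun x y z => lt3 y z x) = S lt3 by rewrite -lt3_132 S12.
have lt3_321 : S (fun x y z => lt3 z y x) = S lt3 by rewrite -lt3_312 S12.
have eq_13 : S (fun x _ z => x == z) = S (fun x y _ => x == y).
  by rewrite (S23 (fun x y _ => x == y)).
have eq_23 : S (fun _ y z => y == z) = S (fun x y _ => x == y).
  by rewrite -eq_13 S12.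
have M3 : (macmahon 3 n)%:Z = S lt3 by apply: macmahon_3.
suff : \sum_(t <- hexes n) hex_mul t
    + 2 * S (fun x y z => (x == y) && (y == z))
  = S lt3 + S (fun x y z => lt3 y x z) + S (fun x y z => lt3 x z y)
    + S (fun x y z => lt3 z x y) + S (fun x y z => lt3 y z x)
    + S (fun x y z => lt3 z y x) + S (fun x y _ => x == y)
    + S (fun x _ z => x == z) + S (fun _ y z => y == z).
  rewrite lt3_213 lt3_132 lt3_312 lt3_231 lt3_321 eq_13 eq_23 M3 /S; lra.
have SE P : S P = \sum_(t <- hexes n) (P t.1.1.2 t.1.2.2 t.2.2)%:R * hex_mul t.
  rewrite /S big_mkcond; apply: eq_bigr => t _.
  by case: (P _ _ _); rewrite ?mul1r ?mul0r.
rewrite !SE mulr_sumr -!big_split; apply: eq_bigr => t _ /=.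
rewrite /lt3 mulrA -!mulrDl -{1}[hex_mul t]mul1r -mulrDl; congr (_ * _).
by case: (ltngtP t.1.1.2 t.1.2.2); case: (ltngtP t.1.2.2 t.2.2);
  case: (ltngtP t.1.1.2 t.2.2) => //=; lia.
Qed.

Lemma macmahon_3_closed n :
  1920 * (macmahon 3 n)%:Z
    = (40 * n%:Z ^+ 2 - 100 * n%:Z + 37) * divisor_sum 1 n
      - (30 * n%:Z - 50) * divisor_sum 3 n + 3 * divisor_sum 5 n.
Proof.
have := macmahon_3_newton n; have := sum_hexes_mul n; have := sum_hexes_eq3 n.
have := sum_hexes_eq2 n.
have -> : \sum_(t <- quads n) (t.1.1%:Z ^+ 3 - t.1.1%:Z) * t.2.1%:Z
    = \sum_(t <- quads n) t.1.1%:Z ^+ 3 * t.2.1%:Z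
      - \sum_(t <- quads n) t.1.1%:Z * t.2.1%:Z.
  by rewrite -sumrB; apply: eq_bigr => t _; ring.
have := ramanujan_sigma3_sigma1 n; have := ramanujan_sigma1_sigma1 n.
(* The linear arithmetic procedure treats the products of n with the divisor
   sums as unknowns, so the multiple by n of the relation is supplied. *)
have := congr1 ( *%R n%:Z) (ramanujan_sigma1_sigma1 n); lra.
Qed.

(** * Detecting primes *)

Lemma divisor_sum_detects_primes n (g : nat -> int) :
    (0 < n)%N -> g 1%N + g n = 0 ->
    (forall d, (1 < d < n)%N -> 0 < g d) ->
  let s := \sum_(1 <= d < n.+1 | (d %| n)%N) g d in
  0 <= s /\ ((2 <= n)%N -> (s = 0 <-> prime n)).
Proof.
move=> n_gt0 g1n g_gt0 s.
have [n_le1|n_gt1] := leqP n 1.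
  have n1 : n = 1%N by lia.
  have -> : s = g 1%N by rewrite /s n1 big_mkcond big_nat1.
  by rewrite n1 in g1n *; split=> //; lia.
have -> : s = \sum_(2 <= d < n | (d %| n)%N) g d.
  rewrite /s big_mkcond big_ltn // big_nat_recr //= dvd1n dvdnn.
  rewrite -[X in _ + (X + _)]big_mkcond; lra.
have g_ge0 d : d \in index_iota 2 n -> 0 <= g d.
  by rewrite mem_index_iota => d_n; rewrite ltW ?g_gt0.
split; first by rewrite big_seq_cond sumr_ge0 // => d /andP[/g_ge0].
move=> _; split=> [s0 | pr_n]; last first.
  rewrite big_seq_cond big1 // => d /andP[]; rewrite mem_index_iota => d_n d_dv_n.
  move/primeP: pr_n => [_ /(_ d d_dv_n)]; lia.
apply/negPn/negP=> /primePn[|[d d_n d_dv_n]]; first by lia.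
have d_iota : d \in index_iota 2 n by rewrite mem_index_iota.
move: s0; rewrite (big_rem d) //= d_dv_n /= => s0.
have := g_gt0 d d_n.
suff : 0 <= \sum_(i <- rem d (index_iota 2 n) | (i %| n)%N) g i.
  by lra.
by rewrite big_seq_cond sumr_ge0 // => i /andP[/mem_rem/g_ge0].
Qed.

Lemma detector_2_divisor_sum n :
  (n%:Z ^+ 2 - 3 * n%:Z + 2) * (macmahon 1 n)%:Z - 8 * (macmahon 2 n)%:Z
    = \sum_(1 <= d < n.+1 | (d %| n)%N)
        d%:Z * (n%:Z ^+ 2 - n%:Z + 1 - d%:Z ^+ 2).
Proof.
rewrite macmahon_1 macmahon_2_closed.
transitivity ((n%:Z ^+ 2 - n%:Z + 1) * divisor_sum 1 n - divisor_sum 3 n);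
  first ring.
by rewrite mulr_sumr -sumrB; apply: eq_bigr => d _; ring.
Qed.

(** The factor 2 clears the denominator of 3/2. *)
Lemma detector_3_divisor_sum n :
  2 * ((3 * n%:Z ^+ 3 - 13 * n%:Z ^+ 2 + 18 * n%:Z - 8) * (macmahon 1 n)%:Z
       + (12 * n%:Z ^+ 2 - 120 * n%:Z + 212) * (macmahon 2 n)%:Z
       - 960 * (macmahon 3 n)%:Z)
    = \sum_(1 <= d < n.+1 | (d %| n)%N)
        3 * d%:Z * (d%:Z ^+ 2 - 1) * (n%:Z ^+ 2 - d%:Z ^+ 2).
Proof.
transitivity (3 * ((n%:Z ^+ 2 + 1) * divisor_sum 3 n - n%:Z ^+ 2 * divisor_sum 1 n
  - divisor_sum 5 n)).
  have := macmahon_3_closed n; rewrite macmahon_1.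
  have := congr1 ( *%R (3 * n%:Z ^+ 2 - 30 * n%:Z + 53)) (macmahon_2_closed n).
  lra.
rewrite [in LHS]/divisor_sum !mulr_sumr -!sumrB mulr_sumr.
by apply: eq_bigr => d _; ring.
Qed.

Theorem theorem1p1 :
  ((forall n : nat, (0 < n)%N ->
      (n%:Z ^+ 2 - 3 * n%:Z + 2) * (macmahon 1 n)%:Z
        - 8 * (macmahon 2 n)%:Z >= 0)
   /\
   (forall n : nat, (2 <= n)%N ->
      ((n%:Z ^+ 2 - 3 * n%:Z + 2) * (macmahon 1 n)%:Z
         - 8 * (macmahon 2 n)%:Z = 0 <-> prime n)))
  /\
  ((forall n : nat, (0 < n)%N ->
      (3 * n%:Z ^+ 3 - 13 * n%:Z ^+ 2 + 18 * n%:Z - 8) * (macmahon 1 n)%:Z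
        + (12 * n%:Z ^+ 2 - 120 * n%:Z + 212) * (macmahon 2 n)%:Z
        - 960 * (macmahon 3 n)%:Z >= 0)
   /\
   (forall n : nat, (2 <= n)%N ->
      ((3 * n%:Z ^+ 3 - 13 * n%:Z ^+ 2 + 18 * n%:Z - 8) * (macmahon 1 n)%:Z
         + (12 * n%:Z ^+ 2 - 120 * n%:Z + 212) * (macmahon 2 n)%:Z
         - 960 * (macmahon 3 n)%:Z = 0 <-> prime n))).
Proof.
have detects_2 n : (0 < n)%N ->
    let s := \sum_(1 <= d < n.+1 | (d %| n)%N)
               d%:Z * (n%:Z ^+ 2 - n%:Z + 1 - d%:Z ^+ 2) in
    0 <= s /\ ((2 <= n)%N -> (s = 0 <-> prime n)).
  move=> n_gt0; apply: (divisor_sum_detects_primes n_gt0); first by ring.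
  move=> d /andP[d_gt1 lt_dn].
    (* d <= n - 1, and (n - 1)^2 = n^2 - 2n + 1 < n^2 - n + 1 *)
have : d%:Z * d%:Z <= (n%:Z - 1) * (n%:Z - 1) by apply: ler_pM; lia.
  by move=> d2_le; apply: mulr_gt0; lia.
have detects_3 n : (0 < n)%N ->
    let s := \sum_(1 <= d < n.+1 | (d %| n)%N)
               3 * d%:Z * (d%:Z ^+ 2 - 1) * (n%:Z ^+ 2 - d%:Z ^+ 2) in
    0 <= s /\ ((2 <= n)%N -> (s = 0 <-> prime n)).
  move=> n_gt0; apply: (divisor_sum_detects_primes n_gt0); first by ring.
  move=> d /andP[d_gt1 lt_dn]; rewrite !mulr_gt0 //; first lia.
    by rewrite subr_gt0 expr_gt1; lia.
  by rewrite subr_gt0 ltr_pXn2r ?nnegrE; lia.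
split; split=> n n_gt.
- by rewrite detector_2_divisor_sum; case: (detects_2 n n_gt).
- by rewrite detector_2_divisor_sum; case: (detects_2 n (ltnW n_gt)) => _; apply.
- by have [] := detects_3 n n_gt; rewrite -detector_3_divisor_sum; lia.
have [_ /(_ n_gt) <-] := detects_3 n (ltnW n_gt).
by rewrite -detector_3_divisor_sum; split; lia.
Qed.
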